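(* Let $X$ be a non-empty compact metric space. The function $\Delta'_{\mathrm{L}}: \mathcal{K}(X) \to \mathbb{R}$ defined by \[ \Delta'_{\mathrm{L}}(F) = \dim_{\mathrm{L}} F \] is of Baire class 2.
   Context: $\mathcal{K}(X)$ is the set of all non-empty compact subsets of $X$ with the Hausdorff metric $d_{\mathcal H}(E,F)=\inf\{\varepsilon>0: E\subseteq F_\varepsilon \text{ and } F\subseteq E_\varepsilon\}$, where $E_\varepsilon$ is the $\varepsilon$-neighbourhood of $E$. A function between metric spaces is Baire class $0$ if it is continuous, and Baire class $n+1$ if it is a pointwise limit of a sequence of Baire class $n$ functions. For a subset $E$ of a metric space and $r>0$, $N(E,r)$ denotes the minimal number of balls of radius $r$ required to cover $E$, and $B(x,R)$ is the ball of radius $R$ centred at $x$. The lower dimension of $F$ is \[ \dim_{\mathrm L} F = \sup\Big\{\alpha : \exists C>0,\ \exists \rho>0,\ \forall\, 0<r<R\leq\rho,\ \forall x\in F,\ N(B(x,R)\cap F,r)\geq C (R/r)^{\alpha}\Big\}. \]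
   Formalization: Since the lower dimension of a compact set can be infinite, the function is shown to be Baire class 2 with values in the extended reals for every non-empty compact X, and Baire class 2 as a real-valued function whenever every non-empty compact subset of X has finite lower dimension. *)

(* Defs.v *)
From HB Require Import structures.
From mathcomp Require Import all_boot all_order all_algebra.
From mathcomp Require Import all_classical all_reals all_analysis.

Set Implicit Arguments.
Unset Strict Implicit.
Unset Printing Implicit Defensive.

Import Order.TTheory GRing.Theory Num.Theory.
Import numFieldNormedType.Exports.
Local Open Scope classical_set_scope.
Local Open Scope ring_scope.

(* Baire classes only depend on the topologies, so the definition is given for
   topological spaces; it is used between (extended) metric ones. *)
Fixpoint baire_class (n : nat) (T U : topologicalType) (f : T -> U) : Prop :=
  match n with
  | 0 => continuous f
  | n'.+1 => exists g : nat -> T -> U,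
      (forall k, baire_class n' (g k)) /\
      (forall x, (fun k => g k x) @ \oo --> f x)
  end.

Section hausdorff_distance.
Context {R : realType} {X : metricType R}.
Implicit Types (E F G : set X) (e : R).

Definition thickening E e : set X := [set y | exists2 x, E x & mdist x y < e].

Definition hausdorff_dist E F : R :=
  inf [set e | [/\ 0 < e, E `<=` thickening F e & F `<=` thickening E e]].

Lemma compact_sub_ball E x0 : compact E ->
  \forall e \near +oo, E `<=` ball x0 e.
Proof.
move=> /compact_near_coveringP /(_ R (+oo)%R (fun e x => ball x0 e x)) cE.
suff : \forall e \near +oo, forall x, E x -> ball x0 e x by [].
apply: cE => x _.
exists (ball x 1, [set e | mdist x0 x + 1 < e]).
  split => /=; first exact: nbhsx_ballx.
  by exists (mdist x0 x + 1); split => //; exact: num_real.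
move=> [y e] /= [+ lte]; rewrite !ballEmdist /= => xy.
by rewrite (le_lt_trans (metric_triangle x0 x y))// (lt_trans _ lte)// ltrD2l.
Qed.

Lemma hausdorff_set_nonempty E F : E !=set0 -> F !=set0 ->
  compact E -> compact F ->
  [set e | [/\ 0 < e, E `<=` thickening F e & F `<=` thickening E e]] !=set0.
Proof.
move=> [x0 Ex0] [y0 Fy0] cE cF.
near (pinfty_nbhs R) => e; exists e; split.
- by near: e; exact: nbhs_pinfty_gt.
- have EB : E `<=` ball y0 e by near: e; exact: compact_sub_ball.
  by move=> x /EB; rewrite ballEmdist => ?; exists y0.
- have FB : F `<=` ball x0 e by near: e; exact: compact_sub_ball.
  by move=> x /FB; rewrite ballEmdist => ?; exists x0.
Unshelve. all: by end_near. Qed.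

Lemma hausdorff_dist_le E F e : 0 < e -> E `<=` thickening F e ->
  F `<=` thickening E e -> hausdorff_dist E F <= e.
Proof.
move=> e0 EF FE; apply: ge_inf => //.
by exists 0 => d [/ltW].
Qed.

Lemma hausdorff_dist_lt E F e : E !=set0 -> F !=set0 ->
  compact E -> compact F -> hausdorff_dist E F < e ->
  [/\ 0 < e, E `<=` thickening F e & F `<=` thickening E e].
Proof.
move=> E0 F0 cE cF.
move=> /(inf_lt (hausdorff_set_nonempty E0 F0 cE cF))[d [d0 EF FE] de].
split; first exact: lt_trans de.
- by move=> x /EF[y Fy yx]; exists y => //; exact: lt_trans de.
- by move=> x /FE[y Ey yx]; exists y => //; exact: lt_trans de.
Qed.

Lemma thickening_trans E F G e e' : E `<=` thickening F e ->
  F `<=` thickening G e' -> E `<=` thickening G (e + e').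
Proof.
move=> EF FG x /EF[y /FG[z Gz zy] yx]; exists z => //.
by rewrite (le_lt_trans (metric_triangle z y x))// addrC ltrD.
Qed.

End hausdorff_distance.

Record compacts {R : realType} (X : metricType R) := Compacts {
  compacts_set :> set X ;
  compacts_nonempty : compacts_set !=set0 ;
  compacts_compact : compact compacts_set }.

Section compacts_metric.
Context {R : realType} {X : metricType R}.
Implicit Types E F G : compacts X.

Lemma compacts_inj E F : E = F :> set X -> E = F.
Proof.
case: E F => [E E0 cE] [F F0 cF] /= EF; rewrite EF in E0 cE *.
by congr Compacts; exact: Prop_irrelevance.
Qed.

HB.instance Definition _ := gen_eqMixin (compacts X).
HB.instance Definition _ := gen_choiceMixin (compacts X).

Let lt_dist E F e : hausdorff_dist E F < e ->
  [/\ 0 < e, E `<=` thickening F e & F `<=` thickening E e].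
Proof.
by apply: hausdorff_dist_lt; [exact: compacts_nonempty.. | exact: compacts_compact
  | exact: compacts_compact].
Qed.

Let dist_ge0 E F : 0 <= hausdorff_dist E F.
Proof.
rewrite leNgt; apply/negP => /lt_dist[]; by rewrite ltxx.
Qed.

Let distxx E : hausdorff_dist E E = 0.
Proof.
apply/eqP; rewrite eq_le dist_ge0 andbT; apply/ler_addgt0Pl => e e0.
rewrite addr0; apply: hausdorff_dist_le => // x Ex; exists x => //;
  by rewrite mdistxx.
Qed.

Let dist_sym E F : hausdorff_dist E F = hausdorff_dist F E.
Proof.
by rewrite /hausdorff_dist; congr inf; apply/seteqP; split => e /= [].
Qed.

Let dist_triangle F E G :
  hausdorff_dist E G <= hausdorff_dist E F + hausdorff_dist F G.
Proof.
apply/ler_addgt0Pl => e e0.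
have /lt_dist[a0 EF FE] : hausdorff_dist E F < hausdorff_dist E F + e / 2.
  by rewrite ltrDl divr_gt0.
have /lt_dist[b0 FG GF] : hausdorff_dist F G < hausdorff_dist F G + e / 2.
  by rewrite ltrDl divr_gt0.
rewrite addrC [in leRHS](splitr e) addrACA.
apply: hausdorff_dist_le; first exact: addr_gt0.
- exact: thickening_trans EF FG.
- by rewrite addrC; exact: thickening_trans GF FE.
Qed.

Let dist_eq0 E F : hausdorff_dist E F = 0 -> E = F.
Proof.
have sub (G H : compacts X) : hausdorff_dist G H = 0 -> G `<=` H.
  move=> GH x Gx; have : closed H.
    by apply: compact_closed; [exact: metric_hausdorff | exact: compacts_compact].
  apply => B /nbhs_ballP[e /= e0 xeB].
  have /lt_dist[_ /(_ x Gx)[y Hy yx] _] : hausdorff_dist G H < e by rewrite GH.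
  by exists y; split => //; apply: xeB; rewrite ballEmdist /= metric_sym.
move=> EF; apply: compacts_inj; apply/seteqP; split; apply: sub => //.
by rewrite dist_sym.
Qed.

HB.instance Definition _ := @isMetric.Build R (compacts X)
  (fun E F => hausdorff_dist E F) distxx dist_eq0 dist_sym dist_triangle.

End compacts_metric.

Section lower_dimension.
Context {R : realType} {X : metricType R}.

(* The value is +oo when no finite cover exists; the centres of the (open)
   balls range over X. *)
Definition covering_number (E : set X) (r : R) : \bar R :=
  ereal_inf [set ((size s)%:R)%:E | s in
    [set s : seq X | E `<=` \bigcup_(c in [set` s]) ball c r]].

(* The supremum is taken in the extended reals: a compact metric space can have
   subsets of infinite lower dimension. *)
Definition lower_dim (F : set X) : \bar R :=
  ereal_sup [set a%:E | a in [set a : R |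
    exists C : R, 0 < C /\ exists rho : R, 0 < rho /\
      forall r S : R, 0 < r -> r < S -> S <= rho ->
      forall x : X, F x ->
        ((C * (S / r) `^ a)%:E <= covering_number (ball x S `&` F) r)%E]].

End lower_dimension.

(* Main.v *)
Require Import Defs.
From mathcomp Require Import all_boot all_order all_algebra.
From mathcomp Require Import all_classical all_reals all_analysis.
From mathcomp Require Import lra.
Import Order.TTheory GRing.Theory Num.Theory.
Import numFieldNormedType.Exports.
Local Open Scope classical_set_scope.
Local Open Scope ring_scope.

(** The quantifiers over the constants [C] and [rho] in the definition of the
    lower dimension only matter as both constants tend to [0], so they may be
    tied together and run through [1 / (n + 1)].  Let [lower_exponent n F] be
    the largest exponent [a <= n] such that every cover of [B(x, S) `&` F] by
    [r]-balls has at least [(S / r)^a / (n + 1)] members whenever [x] is in [F]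
    and [r < S <= 1 / (n + 1)].  These numbers are nondecreasing in [n] and
    converge to the lower dimension ([lower_exponent_cvg]), so it is enough that
    each of them is of Baire class 1 as a function of [F].

    For fixed [n] the function [lower_exponent n] is upper semicontinuous.  The
    reason is that the failure of the scaling inequality is an open condition on
    [F] ([not_lower_regular_near]): a failure is witnessed by a finite family of
    open balls which covers [B(x, S) `&` F] and has too few members.  As [F] is
    compact, for [t < S] the same family covers [B(y, t) `&` G] for every compact
    [G] close enough to [F] and a suitable [y] in [G] near [x]
    ([cover_stable]); and since [t] can be taken so close to [S] that
    [(t / r)^a] is almost [(S / r)^a], the family is too small for [G] as well.

    Finally, a bounded upper semicontinuous function on a metric space is the
    pointwise limit of its Lipschitz majorants
    ([upper_semicontinuous_baire1]).  The functions [lower_exponent n] are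
    real-valued, so one sequence serves both for the extended-real-valued
    dimension and for the real-valued one. *)

(** * Baire classes and semicontinuous functions *)

Lemma baire_class_comp (n : nat) (T U V : topologicalType) (f : T -> U)
    (g : U -> V) :
  continuous g -> baire_class n f -> baire_class n (g \o f).
Proof.
move=> cg; elim: n f => [|n IHn] f /=.
  by move=> cf x; apply: continuous_comp; [exact: cf|exact: cg].
move=> [u [un uf]]; exists (fun k => g \o u k); split=> [k|x].
  exact: IHn.
by apply: continuous_cvg; [exact: cg|exact: uf].
Qed.

Lemma EFin_continuous (R : realType) : continuous (@EFin R).
Proof. by move=> x; apply: cvg_EFin; [exact: nearW|exact: cvg_id]. Qed.

Section semicontinuous.
Context {R : realType} {T : metricType R}.
Variables (f : T -> R) (M : R).
Hypothesis f_ge0 : forall x, 0 <= f x.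
Hypothesis f_le : forall x, f x <= M.

Let lip_set (k : nat) (x : T) := [set f y - k%:R * mdist x y | y in [set: T]].

(** The sup-convolution of [f] with the cone of slope [k]: the least
    [k]-Lipschitz function above [f]. *)
Definition lipschitz_majorant (k : nat) (x : T) : R := sup (lip_set k x).

Let lip_set_ub k x : ubound (lip_set k x) M.
Proof.
move=> _ [y _ <-]; rewrite (le_trans _ (f_le y))// gerBl.
by rewrite mulr_ge0// mdist_ge0.
Qed.

Let lip_set0 k x : lip_set k x !=set0.
Proof. by exists (f x - k%:R * mdist x x), x. Qed.

Let majorant_ge k x y : f y - k%:R * mdist x y <= lipschitz_majorant k x.
Proof.
apply: ub_le_sup; last by exists y.
by exists M; exact: lip_set_ub.
Qed.

Let majorantD k x y :
  lipschitz_majorant k x <= lipschitz_majorant k y + k%:R * mdist x y.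
Proof.
apply: ge_sup => // _ [z _ <-].
rewrite (le_trans _ (lerD (majorant_ge k y z) (lexx _)))//.
have : k%:R * mdist y z <= k%:R * mdist x y + k%:R * mdist x z.
  by rewrite -mulrDr ler_wpM2l// (metric_sym x y) metric_triangle.
lra.
Qed.

Lemma lipschitz_majorant_continuous k : continuous (lipschitz_majorant k).
Proof.
move=> x; apply/cvgrPdist_le => e e0; near=> y.
have d0 := mdist_ge0 x y.
have xy : k%:R * mdist x y <= e.
  have : mdist x y < e / k.+1%:R.
    near: y; apply/metricType_numDomainType.nbhs_mdistP.
    by exists (e / k.+1%:R) => //=; rewrite divr_gt0.
  rewrite ltr_pdivlMr// => /ltW; apply: le_trans.
  by rewrite mulrC ler_wpM2l// ler_nat.
rewrite ler_norml; apply/andP; split.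
  by rewrite lerBrDl lerBlDr (le_trans (majorantD k y x))// metric_sym lerD2l.
by rewrite lerBlDl (le_trans (majorantD k x y))// lerD2l.
Unshelve. all: by end_near. Qed.

(** Near [x] semicontinuity keeps [f y] below [f x + e]; away from [x] the
    penalty [k * mdist x y] eventually exceeds the bound [M], so the points [y]
    there contribute at most [0 <= f x] to the majorant at [x]. *)
Lemma upper_semicontinuous_baire1 :
  (forall x e, 0 < e -> \forall y \near x, f y <= f x + e) -> baire_class 1 f.
Proof.
move=> f_usc; exists lipschitz_majorant; split.
  exact: lipschitz_majorant_continuous.
move=> x; apply/cvgrPdist_le => e e0.
have /metricType_numDomainType.nbhs_mdistP[d /= d0 fd] := f_usc x e e0.
near=> k.
have kd : M <= k%:R * d.
  rewrite -ler_pdivrMr//; near: k.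
  exact: nbhs_infty_ger.
have fk : f x <= lipschitz_majorant k x.
  by rewrite (le_trans _ (majorant_ge k x x))// mdistxx mulr0 subr0.
rewrite distrC ger0_norm ?subr_ge0// lerBlDl.
apply: ge_sup => // _ [y _ <-].
have [xy|dy] := ltP (mdist x y) d.
  by rewrite (le_trans _ (fd y xy))// gerBl mulr_ge0// mdist_ge0.
rewrite (@le_trans _ _ 0)//; last by rewrite addr_ge0// ltW.
by rewrite subr_le0 (le_trans (f_le y))// (le_trans kd)// ler_wpM2l.
Unshelve. all: by end_near. Qed.

End semicontinuous.

(** * Exponents with prescribed constants *)

Section lower_exponents.
Context {R : realType} {X : metricType R}.

(** The single parameter [c] stands both for the multiplicative constant and for
    the largest scale, which makes the condition weaker as [c] decreases. *)
Definition lower_regular (c a : R) (F : set X) : Prop :=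
  forall r S : R, 0 < r -> r < S -> S <= c -> forall x : X, F x ->
    ((c * (S / r) `^ a)%:E <= covering_number (ball x S `&` F) r)%E.

(** The cap [a <= n] keeps the supremum finite: on a finite-dimensional [F] it
    disappears in the limit, and otherwise it grows to [+oo]. *)
Definition lower_exponent (n : nat) (F : set X) : R :=
  sup [set a | a <= n%:R /\ lower_regular n.+1%:R^-1 a F].

Lemma lower_regular_le (c c' a a' : R) (F : set X) :
  0 <= c -> c <= c' -> a <= a' ->
  lower_regular c' a' F -> lower_regular c a F.
Proof.
move=> c0 cc aa reg r S r0 rS Sc x Fx.
apply: (le_trans _ (reg r S r0 rS (le_trans Sc cc) x Fx)).
rewrite lee_fin ler_pM ?powR_ge0// ler_powR//.
by rewrite ler_pdivlMr// mul1r ltW.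
Qed.

Lemma covering_number_ge1 (E : set X) (r : R) :
  E !=set0 -> (1 <= covering_number E r)%E.
Proof.
move=> [x Ex]; apply/ereal_infP => _ [s sE <-]; rewrite lee_fin ler1n lt0n.
by apply/eqP => /size0nil s0; have [c] := sE x Ex; rewrite /= s0.
Qed.

(** The exponent [0] is admissible because a ball centred in [F] meets [F]; this
    is what makes the set of exponents nonempty. *)
Lemma lower_regular0 (c : R) (F : set X) : c <= 1 -> lower_regular c 0 F.
Proof.
move=> c1 r S r0 rS _ x Fx.
rewrite powRr0 mulr1 (@le_trans _ _ 1%E)// ?lee_fin//.
apply: covering_number_ge1.
by exists x; split=> //; apply: ballxx; exact: lt_trans rS.
Qed.

Let invS_le1 n : n.+1%:R^-1 <= 1 :> R.
Proof. by rewrite invf_le1// ler1n. Qed.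

Lemma lower_exponent_ub (n : nat) (F : set X) (a : R) :
  a <= n%:R -> lower_regular n.+1%:R^-1 a F -> a <= lower_exponent n F.
Proof. by move=> an aF; apply: ub_le_sup => //; exists n%:R => b []. Qed.

Lemma lower_exponent_lub (n : nat) (F : set X) (b : R) :
  (forall a, a <= n%:R -> lower_regular n.+1%:R^-1 a F -> a <= b) ->
  lower_exponent n F <= b.
Proof.
move=> ub; apply: ge_sup => [|a []]; last exact: ub.
by exists 0; split=> //; exact: lower_regular0.
Qed.

Lemma lower_exponent_ge0 (n : nat) (F : set X) : 0 <= lower_exponent n F.
Proof. by apply: lower_exponent_ub => //; exact: lower_regular0. Qed.

Lemma lower_exponent_le (n : nat) (F : set X) : lower_exponent n F <= n%:R.
Proof. exact: lower_exponent_lub. Qed.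

Lemma lower_exponent_homo (F : set X) :
  {homo (fun n => lower_exponent n F) : m n / (m <= n)%N >-> m <= n}.
Proof.
move=> m n mn; apply: lower_exponent_lub => a am aF.
apply: lower_exponent_ub; first by rewrite (le_trans am)// ler_nat.
by apply: lower_regular_le aF; rewrite ?lef_pV2 ?posrE ?ler_nat.
Qed.

(** Each admissible triple of an exponent and two constants is dominated by some
    [1 / (n + 1)], so the lower dimension is the supremum of the nondecreasing
    sequence. *)
Lemma lower_exponent_cvg (F : set X) :
  (lower_exponent n F)%:E @[n --> \oo] --> lower_dim F.
Proof.
have -> : lower_dim F = ereal_sup (range (fun n => (lower_exponent n F)%:E)).
  apply/eqP; rewrite eq_le; apply/andP; split.
    apply: ge_ereal_sup => _ [a [C [C0 [rho [rho0 reg]]]] <-].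
    (* an admissible triple [(a, C, rho)] is admissible for every index above
       [a], [1 / C] and [1 / rho] *)
    pose m := Num.max a (Num.max C^-1 rho^-1).
    have [n mn] : exists n : nat, m <= n%:R.
      exists (Num.truncn `|m|).+1.
      by rewrite ltW// (le_lt_trans (ler_norm _))// truncnS_gt.
    apply: (@le_trans _ _ (lower_exponent n F)%:E); last first.
      by apply: ereal_sup_ubound; exists n.
    have [an Cn rn] : [/\ a <= n%:R, C^-1 <= n%:R & rho^-1 <= n%:R].
      by move: mn; rewrite !ge_max => /and3P[].
    have small d : 0 < d -> d^-1 <= n%:R -> n.+1%:R^-1 <= d :> R.
      move=> d0 dn; rewrite -[leRHS]invrK lef_pV2 ?posrE ?invr_gt0//.
      by rewrite (le_trans dn)// ler_nat.
    rewrite lee_fin; apply: lower_exponent_ub => // r S r0 rS Sn x Fx.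
    apply: (le_trans _ (reg r S r0 rS (le_trans Sn (small _ rho0 rn)) x Fx)).
    by rewrite lee_fin ler_wpM2r ?powR_ge0// small.
  apply: ge_ereal_sup => _ [n _ <-].
  rewrite /lower_exponent -ereal_sup_EFin; last 2 first.
  - by exists n%:R => b [].
  - by exists 0; split=> //; exact: lower_regular0.
  apply: le_ereal_sup => _ [a [_ reg] <-]; exists a => //.
  by exists n.+1%:R^-1; split=> //; exists n.+1%:R^-1.
apply: ereal_nondecreasing_cvgn => m n mn.
by rewrite lee_fin lower_exponent_homo.
Qed.

(** * Openness of the failure of regularity *)

Lemma metric_ball_open (x : X) (r : R) : open (ball x r).
Proof.
rewrite openE => y; rewrite ballEmdist /= => xy.
apply/metricType_numDomainType.nbhs_mdistP.
exists (r - mdist x y); first by rewrite /= subr_gt0.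
by move=> z /= yz; rewrite (le_lt_trans (metric_triangle x y z))// -ltrBrDl.
Qed.

(** A Lebesgue number: by compactness the points of [F] well inside the ball lie
    uniformly deep in [U].  Points [y] of [F] at distance at least [S] from [x]
    need not be in [U], but a small ball around them avoids the ball of radius
    [S' < S], so they cause no harm. *)
Lemma uniform_neighbourhood (F : set X) (U : set X) (x : X) (S S' : R) :
  compact F -> open U -> ball x S `&` F `<=` U -> S' < S ->
  \forall e \near 0^'+, forall y, F y -> mdist x y < S' -> ball y e `<=` U.
Proof.
move=> cF oU xU SS.
suff : \forall e \near (0 : R)^'+,
    F `<=` [set y | mdist x y < S' -> ball y e `<=` U].
  by [].
move/compact_near_coveringP : cF; apply => y Fy.
have [yS|Sy] := ltP (mdist x y) S.
  have /nbhs_ballP[d /= d0 dU] : nbhs y U.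
    by apply: open_nbhs_nbhs; split=> //; apply: xU; rewrite ballEmdist.
  exists (ball y (d / 2), [set e | e < d / 2]) => /=.
    split; first by apply: nbhsx_ballx; rewrite divr_gt0.
    by apply: nbhs_right_lt; rewrite divr_gt0.
  move=> [z e] /= [yz ed] _ w zw; apply: dU.
  by rewrite (splitr d); apply: ball_triangle yz _; apply: le_ball zw; exact: ltW.
exists (ball y (S - S'), setT) => /=.
  by split; [apply: nbhsx_ballx; rewrite subr_gt0 | exact: filterT].
move=> [z e] /= [yz _] xz; exfalso.
have : mdist x y < S.
  rewrite (le_lt_trans (metric_triangle x z y))// -(subrK S' S) addrC.
  by rewrite ltrD// metric_sym; move: yz; rewrite ballEmdist.
by rewrite ltNge Sy.
Qed.

(** Whatever lies in [G] within [S'] of a point [y] close to [x] is close to a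
    point of [F] that is still within [S] of [x], hence is in [U] by
    [uniform_neighbourhood]. *)
Lemma cover_stable (F : compacts X) (U : set X) (x : X) (S S' : R) :
  compacts_set F x -> open U -> ball x S `&` F `<=` U -> S' < S ->
  \forall G \near F, exists2 y, compacts_set G y & ball y S' `&` G `<=` U.
Proof.
move=> Fx oU xU SS.
(* half of the gap [S - S'] absorbs two moves of length [e <= (S - S') / 4],
   from [x] to [y] and from a point of [G] to one of [F] *)
have S2 : (S' + S) / 2 < S by rewrite ltr_pdivrMr// mulr_natr mulr2n ltrD2r.
near (0 : R)^'+ => e.
have e0 : 0 < e by near: e; exact: nbhs_right_gt.
have eU : forall y, compacts_set F y -> mdist x y < (S' + S) / 2 ->
    ball y e `<=` U.
  by near: e; exact: (@uniform_neighbourhood F U x S _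
                       (@compacts_compact _ _ F) oU xU S2).
have e4 : e <= (S - S') / 4.
  by near: e; apply: nbhs_right_le; rewrite divr_gt0// subr_gt0.
apply/metricType_numDomainType.nbhs_mdistP; exists e => //= G FG.
have [_ FGe GFe] := hausdorff_dist_lt (@compacts_nonempty _ _ F)
  (@compacts_nonempty _ _ G) (@compacts_compact _ _ F) (@compacts_compact _ _ G)
  FG.
have [y Gy yx] := FGe x Fx; exists y => // z [yz Gz].
have [w Fw wz] := GFe z Gz.
apply: (eU w Fw); last by rewrite ballEmdist.
have yzS : mdist y z < S' by move: yz; rewrite ballEmdist.
have := metric_triangle x y w; have := metric_triangle y z w.
rewrite (metric_sym x y) (metric_sym z w); lra.
Unshelve. all: by end_near. Qed.

Lemma powR_scale_continuous (r a S : R) : 0 < r -> 0 < S ->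
  {for S, continuous (fun t : R => (t / r) `^ a)}.
Proof.
move=> r0 S0.
apply: (@continuous_comp _ _ _ (fun t : R => t / r) (fun t : R => t `^ a)).
  by apply: cvgMl; exact: cvg_id.
apply: differentiable_continuous; apply/derivable1_diffP.
by apply: derivable_powR; rewrite in_itv/= divr_gt0.
Qed.

(** The witnessing cover is kept and only the radius [S] is shrunk to some
    [t < S]: the strict inequality between its size and [c * (S / r)^a] leaves
    room for that by continuity. *)
Lemma not_lower_regular_near (F : compacts X) (c a : R) :
  ~ lower_regular c a F ->
  \forall G \near F, ~ lower_regular c a (compacts_set G).
Proof.
move=> /existsNP[r] /existsNP[S] /not_implyP[r0] /not_implyP[rS].
move=> /not_implyP[Sc] /existsNP[x] /not_implyP[Fx] /negP.
rewrite -ltNge => /ereal_inf_lt[_ [s sF <-]]; rewrite lte_fin => sS.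
have S0 : 0 < S by exact: lt_trans rS.
have cvgS : c * (t / r) `^ a @[t --> S^'-] --> c * (S / r) `^ a.
  apply: cvg_at_left_filter; apply: cvgMr.
  exact: powR_scale_continuous.
near S^'- => t.
have tS : t < S by near: t; exact: nbhs_left_lt.
have rt : r < t by near: t; exact: nbhs_left_gt.
have st : (size s)%:R < c * (t / r) `^ a by near: t; exact: (cvgr_gt _ cvgS).
have oU : open (\bigcup_(c in [set` s]) ball c r).
  by apply: bigcup_open => z _; exact: metric_ball_open.
apply: filterS (cover_stable _ _ _ _ _ Fx oU sF tS) => G [y Gy yU] reg.
have := reg r t r0 rt (ltW (lt_le_trans tS Sc)) y Gy.
apply/negP; rewrite -ltNge; apply: le_lt_trans (_ : _ <= (size s)%:R%:E)%E _.
  by apply: ereal_inf_lbound; exists s.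
by rewrite lte_fin.
Unshelve. all: by end_near. Qed.

(** By maximality [F] is not regular for the exponent [lower_exponent n F + e],
    when this is below the cap [n]; compact sets near [F] inherit the failure,
    which bounds their exponents. *)
Lemma lower_exponent_baire1 (n : nat) :
  baire_class 1 (fun F : compacts X => lower_exponent n F).
Proof.
apply: (@upper_semicontinuous_baire1 R (compacts X) _ n%:R) => [F|F|F e e0].
- exact: lower_exponent_ge0.
- exact: lower_exponent_le.
have [nF|Fn] := leP n%:R (lower_exponent n F + e).
  by near=> G; exact: le_trans (lower_exponent_le _ _) nF.
have : ~ lower_regular n.+1%:R^-1 (lower_exponent n F + e) F.
  move=> /(lower_exponent_ub _ _ _ (ltW Fn)).
  by rewrite leNgt ltrDl e0.
move=> /not_lower_regular_near nearF; near=> G.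
have nG : ~ lower_regular n.+1%:R^-1 (lower_exponent n F + e) (compacts_set G).
  by near: G.
apply: lower_exponent_lub => a an aG; rewrite leNgt; apply/negP => /ltW Fa.
by apply: nG; exact: lower_regular_le aG.
Unshelve. all: by end_near. Qed.

End lower_exponents.

Theorem theorem5p3 (R : realType) (X : metricType R)
    (X_nonempty : [set: X] !=set0) (X_compact : compact [set: X]) :
  baire_class 2 (fun F : compacts X => lower_dim F) /\
  ((forall F : compacts X, lower_dim F \is a fin_num) ->
   baire_class 2 (fun F : compacts X => fine (lower_dim F))).
Proof.
split=> [|fin].
  exists (fun n => EFin \o (fun F : compacts X => lower_exponent n F)).
  split=> [n|F]; last exact: lower_exponent_cvg.
  apply: baire_class_comp; first exact: EFin_continuous.
  exact: lower_exponent_baire1.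
exists (fun n (F : compacts X) => lower_exponent n F).
split=> [n|F]; first exact: lower_exponent_baire1.
apply: (@fine_cvg _ _ _ _ (fun n => (lower_exponent n F)%:E)).
by rewrite fineK//; exact: lower_exponent_cvg.
Qed.
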